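(* Let $q:\mathsf D\to\mathbb R$ have sensitivity $\Delta q\in(0,\infty)$, and let $k>0$, $\theta>0$. If $\Lambda\sim\Gamma(k,\theta)$ (density $\frac{x^{k-1}e^{-x/\theta}}{\Gamma(k)\theta^k}$ for $x>0$), then the Randomized DP Laplace mechanism with reciprocal scale $\Lambda$ satisfies $\big((k+1)\ln(1+\Delta q\,\theta)\big)$-differential privacy; moreover $\ln[\mathbb E(\Lambda)/M'_\Lambda(-\Delta q)]=(k+1)\ln(1+\Delta q\,\theta)$.
   Context: Databases form a set $\mathsf D$ with a symmetric adjacency relation; the sensitivity of $q$ is $\Delta q=\sup\{|q(d)-q(d')|:d,d'\text{ adjacent}\}$. A mechanism $M$ is $\epsilon$-DP if $\mathbb P(M(d)\in S)\le e^\epsilon\mathbb P(M(d')\in S)$ for all adjacent $d,d'$ and Borel $S$. The Randomized DP Laplace mechanism with reciprocal-scale distribution $\Lambda$ (a random variable with values in $(0,\infty)$, playing the role of $1/b$ for the Laplace scale $b$) is defined by $\mathcal M_q(d)=q(d)+W$, where conditionally on $\Lambda=\lambda$ the noise $W$ is Laplace with mean $0$ and scale $1/\lambda$, i.e. has density $\frac{\lambda}{2}e^{-\lambda|w|}$; the pair $(\Lambda,W)$ is drawn independently of $d$. $M_\Lambda(t)=\mathbb E[e^{t\Lambda}]$, $M'_\Lambda(t)=\mathbb E[\Lambda e^{t\Lambda}]$. *)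

(* Defs.v *)
From HB Require Import structures.
From mathcomp Require Import all_boot all_order all_algebra.
From mathcomp Require Import all_classical all_reals all_analysis.
Set Implicit Arguments. Unset Strict Implicit. Unset Printing Implicit Defensive.
Import Order.TTheory GRing.Theory Num.Theory.
Import numFieldNormedType.Exports.
Local Open Scope classical_set_scope.
Local Open Scope ring_scope.

Definition sensitivity (R : realType) (D : Type) (adj : D -> D -> Prop)
  (q : D -> R) : \bar R :=
  ereal_sup [set r | exists d d', adj d d' /\ r = (`|q d - q d'|)%:E].

Definition GammaFn (R : realType) (k : R) : R :=
  fine (\int[@lebesgue_measure R]_(x in [set x : R | (0 < x)%R])
          ((x `^ (k - 1) * expR (- x))%R)%:E)%E.

Definition gamma_pdf (R : realType) (k theta x : R) : R :=
  x `^ (k - 1) * expR (- x / theta) / (GammaFn k * theta `^ k).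

Definition laplace_pdf (R : realType) (lam w : R) : R :=
  lam / 2 * expR (- lam * `|w|).

Definition gamma_distributed (R : realType) (d0 : measure_display)
  (Omega : measurableType d0) (P : probability Omega R) (Lam : Omega -> R)
  (k theta : R) : Prop :=
  forall A : set R, measurable A ->
    P (Lam @^-1` A) =
    (\int[@lebesgue_measure R]_(x in A `&` [set x : R | (0 < x)%R])
        (gamma_pdf k theta x)%:E)%E.

(* Conditionally on Lam = lam, W is Laplace(0, 1/lam):
   P(Lam ∈ A, W ∈ B) = E[ 1_{Lam ∈ A} ∫_B (Lam/2) e^{-Lam |w|} dw ] *)
Definition laplace_given (R : realType) (d0 : measure_display)
  (Omega : measurableType d0) (P : probability Omega R) (Lam W : Omega -> R)
  : Prop :=
  forall A B : set R, measurable A -> measurable B ->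
    P (Lam @^-1` A `&` W @^-1` B) =
    (\int[P]_(w in Lam @^-1` A)
        \int[@lebesgue_measure R]_(x in B) (laplace_pdf (Lam w) x)%:E)%E.

Definition rand_laplace_mech (R : realType) (d0 : measure_display)
  (Omega : measurableType d0) (D : Type) (q : D -> R) (W : Omega -> R)
  (d : D) : Omega -> R :=
  fun w => q d + W w.

Definition eps_DP (R : realType) (d0 : measure_display)
  (Omega : measurableType d0) (P : probability Omega R) (D : Type)
  (adj : D -> D -> Prop) (M : D -> Omega -> R) (eps : R) : Prop :=
  forall d d', adj d d' -> forall S : set R, measurable S ->
    (P (M d @^-1` S) <= (expR eps)%:E * P (M d' @^-1` S))%E.

Definition mgf_deriv (R : realType) (d0 : measure_display)
  (Omega : measurableType d0) (P : probability Omega R) (Lam : Omega -> R)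
  (t : R) : \bar R :=
  ('E_P[fun w => (Lam w * expR (t * Lam w))%R])%E.

(* Main.v *)
Require Import Defs.
From HB Require Import structures.
From mathcomp Require Import all_boot all_order all_algebra.
From mathcomp Require Import all_classical all_reals all_analysis.
From mathcomp Require Import measurable_realfun ring lra.
Import Order.TTheory GRing.Theory Num.Theory.
Import numFieldNormedType.Exports.
Local Open Scope classical_set_scope.
Local Open Scope ring_scope.

(** The density of the noise is [x |-> E[Lam / 2 * e^(- Lam |x|)]], and for
    [t >= 0] the substitution [x |-> x / s] with [s = 1 / theta + t] in the Gamma
    integral shows that [E[Lam e^(- t Lam)]] is a constant times
    [(1 / theta + t)^(- (k + 1))].  Hence shifting the argument by at most [dq]
    changes the noise density by a factor at most [(1 + dq theta)^(k + 1)], which is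
    also the ratio of the values of [E[Lam e^(- t Lam)]] at [t = 0] and [t = dq].
    No value of the Gamma function is needed: the constant cancels, and its
    finiteness follows from the Gamma law having mass 1. *)

(** * Integration against a measure given by a density *)

Section density.
Local Open Scope ereal_scope.
Import HBNNSimple.

(** The hypothesis on [nu] is the case where [g] is an indicator. Linearity extends it to the simple
    functions approximating [g] from below, and monotone convergence on both sides gives the general
    case. *)
Lemma ge0_integral_density (d : measure_display) (T : measurableType d)
    (R : realType) (mu nu : {measure set T -> \bar R}) (D : set T)
    (p : T -> R) (g : T -> \bar R) :
  measurable D -> measurable_fun D p -> (forall x, D x -> (0 <= p x)%R) ->
  (forall A, measurable A -> nu A = \int[mu]_(x in A `&` D) (p x)%:E) ->
  measurable_fun [set: T] g -> (forall x, 0 <= g x) ->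
  \int[nu]_x g x = \int[mu]_(x in D) (g x * (p x)%:E).
Proof.
move=> mD mp p0 nuE mg g0.
pose h := nnsfun_approx measurableT mg.
have hg x : EFin \o h ^~ x @ \oo --> g x.
  by apply: cvg_nnsfun_approx => // y _; exact: g0.
transitivity (limn (fun n => \int[nu]_x (h n x)%:E)).
  rewrite -monotone_convergence//.
  - by apply: eq_integral => x _; apply/esym/cvg_lim => //; exact: hg.
  - by move=> n; exact/measurable_EFinP.
  - by move=> n x _; rewrite lee_fin.
  - by move=> x _ m n mn; rewrite lee_fin; exact/lefP/nd_nnsfun_approx.
transitivity (limn (fun n => \int[mu]_(x in D) ((h n x)%:E * (p x)%:E))); last first.
  rewrite -monotone_convergence//.
  - apply: eq_integral => x _; apply/cvg_lim => //.
    by apply: cvgeZr => //; exact: hg.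
  - move=> n; apply: emeasurable_funM; last exact/measurable_EFinP.
    by apply/measurable_EFinP/measurable_funTS.
  - by move=> n x Dx; rewrite -EFinM lee_fin mulr_ge0// p0.
  - move=> x Dx m n mn; rewrite -!EFinM lee_fin ler_wpM2r ?p0//.
    exact/lefP/nd_nnsfun_approx.
congr (limn _); apply/funext => n.
rewrite integralT_nnsfun sintegralE.
have hn0 r x : 0 <= (r * \1_(h n @^-1` [set r]) x)%:E by exact: nnfun_muleindic_ge0.
under [RHS]eq_integral do rewrite fimfunE -fsumEFin// ge0_mule_fsuml//.
have mp' : measurable_fun D (EFin \o p) by exact/measurable_EFinP.
rewrite ge0_integral_fsum//; last 2 first.
- move=> r; apply: emeasurable_funM => //.
  by apply/measurable_EFinP/measurable_funTS/measurable_funM.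
- by move=> r x Dx; rewrite mule_ge0// lee_fin p0.
(* Compare one level set at a time: on each, the claim is the density hypothesis [nuE] up to a
   constant factor. *)
apply: eq_fsbigr => r /[!inE] -[t _ <-].
under [RHS]eq_integral do rewrite EFinM -muleA.
rewrite ge0_integralZl//.
- rewrite nuE//; congr (_ * _).
  rewrite integral_mkcondl; apply: eq_integral => x _.
  by rewrite epatch_indic/= muleC.
- apply: emeasurable_funM => //; exact/measurable_EFinP/measurable_funTS.
- by move=> x Dx; rewrite mule_ge0 ?lee_fin ?p0.
- by rewrite lee_fin.
Qed.
End density.

(** * Affine change of variables for the Lebesgue integral *)

Section affine.
Context {R : realType}.
Notation mu := (@lebesgue_measure R).

(** The pushforward of [mu] along [x |-> a * x + c], scaled by [a], agrees with [mu] on half-open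
    intervals, hence equals it by uniqueness of the Lebesgue measure. *)
Lemma ge0_integral_affine (a c : R) (D : set R) (f : R -> \bar R) : 0 < a ->
  measurable D -> measurable_fun D f -> (forall x, D x -> (0 <= f x)%E) ->
  (\int[mu]_(x in D) f x =
   a%:E * \int[mu]_(x in (fun x => (a * x + c)%R) @^-1` D) f (a * x + c)%R)%E.
Proof.
move=> a0 mD mf f0.
have mphi : measurable_fun [set: measurableTypeR R]
    (fun x : measurableTypeR R => a * x + c : measurableTypeR R).
  exact: measurable_funD.
pose phi := fun x : measurableTypeR R => a * x + c : measurableTypeR R.
have a0' := ltW a0.
pose nu_ :
  {measure set (measurableTypeR R) -> \bar R} :=
  mscale (NngNum a0') (pushforward mu phi).
pose nu := nu_ mphi.
transitivity (\int[nu]_(x in D) f x)%E.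
  apply: eq_measure_integral => A mA _.
  apply: lebesgue_measure_unique => //= X [[u v]] _ <-.
  rewrite /nu/nu_/= /mscale/= /pushforward.
  rewrite (_ : _ @^-1` _ = `]((u - c) / a), ((v - c) / a)]%classic).
    rewrite !lebesgue_measure_itv/= !lte_fin ltr_pM2r ?invr_gt0// ltrD2r.
    case: ifP => _; last by rewrite mule0.
    rewrite -!EFinD -EFinM; congr EFin; field; exact: lt0r_neq0.
  apply/seteqP; split => x /=; rewrite !in_itv/= ltr_pdivrMr// ler_pdivlMr//;
   rewrite ltrBlDr lerBrDr mulrC//.
rewrite ge0_integral_mscale//= ge0_integral_pushforward//=.
by move=> x /[!inE]; exact: f0.
Qed.
End affine.

(** * Scaling, positivity and finiteness of Gamma integrals *)

Section gamma_integral.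
Context {R : realType}.
Implicit Types p s t x : R.
Notation mu := (@lebesgue_measure R).
Notation Rpos := [set x : R | 0 < x].

(** For [p > -1] and [s > 0] this is Gamma(p + 1) / s^(p + 1). It stays in the extended reals
    because finiteness is only derived later. *)
Definition gamma_integral p s : \bar R :=
  (\int[mu]_(x in Rpos) (x `^ p * expR (- (s * x)))%:E)%E.

Lemma measurable_Rpos : measurable Rpos.
Proof.
have -> : Rpos = `]0, +oo[%classic by apply/seteqP; split => x /=; rewrite in_itv/= andbT.
exact: measurable_itv.
Qed.

Lemma measurable_powR_expR p s (D : set R) :
  measurable_fun D (fun x => x `^ p * expR (- (s * x))).
Proof.
apply: measurable_funTS; apply: measurable_funM => //.
by apply: measurableT_comp => //; apply: measurableT_comp.
Qed.

(** Substituting [x / s] for [x] isolates the dependence on the rate [s], leaving a constant that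
    cancels in every ratio. *)
Lemma gamma_integral_scale p s : 0 < s ->
  gamma_integral p s = ((s `^ (p + 1))^-1%:E * gamma_integral p 1)%E.
Proof.
move=> s0.
have s'0 : 0 < s^-1 by rewrite invr_gt0.
rewrite /gamma_integral (@ge0_integral_affine _ s^-1 0 Rpos)//; last 3 first.
- exact: measurable_Rpos.
- by apply/measurable_EFinP; exact: measurable_powR_expR.
- by move=> x _; rewrite lee_fin mulr_ge0// ?powR_ge0 ?expR_ge0.
have -> : (fun x : R => s^-1 * x + 0) @^-1` Rpos = Rpos.
  by apply/seteqP; split => x /=; rewrite addr0 pmulr_rgt0.
rewrite -[in RHS]ge0_integralZl; last 4 first.
- exact: measurable_Rpos.
- by apply/measurable_EFinP; exact: measurable_powR_expR.
- by move=> x _; rewrite lee_fin mulr_ge0// ?powR_ge0 ?expR_ge0.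
- by rewrite lee_fin invr_ge0 powR_ge0.
rewrite -ge0_integralZl; last 4 first.
- exact: measurable_Rpos.
- apply/measurable_EFinP; apply: measurable_funTS.
  apply: (measurableT_comp (measurable_powR_expR p s setT)).
  exact: measurable_funD.
- by move=> x _; rewrite lee_fin mulr_ge0// ?powR_ge0 ?expR_ge0.
- by rewrite lee_fin ltW.
apply: eq_integral => x /[!inE]/= x0; rewrite -!EFinM; congr EFin.
rewrite addr0 powRM ?(ltW x0) ?(ltW s'0)// mul1r mulrA divff ?lt0r_neq0// mul1r.
rewrite -[s^-1]powR_inv1 ?(ltW s0)// -powRrM mulN1r -powRN opprD powRD; last first.
  by apply/implyP => _; rewrite gt_eqF.
ring.
Qed.

Lemma gamma_integral_ge0 p s : (0 <= gamma_integral p s)%E.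
Proof.
by apply: integral_ge0 => x _; rewrite lee_fin mulr_ge0// ?powR_ge0 ?expR_ge0.
Qed.

Lemma gamma_integral_gt0 p s : 0 < p -> 0 < s -> (0 < gamma_integral p s)%E.
Proof.
move=> p0 s0.
have m12 : measurable (`[1%R, 2%R]%classic : set R) by exact: measurable_itv.
apply: (@lt_le_trans _ _ (\int[mu]_(x in `[1%R, 2%R]) (expR (- (s * 2)))%:E)%E).
  rewrite integral_cst//= lebesgue_measure_itv/= lte_fin ltr1n -EFinD -EFinM.
  rewrite lte_fin mulr_gt0 ?expR_gt0//; lra.
apply: (@le_trans _ _ (\int[mu]_(x in `[1%R, 2%R]) (x `^ p * expR (- (s * x)))%:E)%E).
  apply: ge0_le_integral => //.
  - by apply/measurable_EFinP; exact: measurable_powR_expR.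
  - move=> x /=; rewrite in_itv/= => /andP[x1 x2]; rewrite lee_fin.
    rewrite -[leLHS]mul1r ler_pM ?expR_ge0//.
      by rewrite -(powRr0 x) ler_powR// ltW.
    by rewrite ler_expR lerN2 ler_pM2l.
apply: ge0_subset_integral => //.
- exact: measurable_Rpos.
- by apply/measurable_EFinP; exact: measurable_powR_expR.
- by move=> x _; rewrite lee_fin mulr_ge0// ?powR_ge0 ?expR_ge0.
- by move=> x /=; rewrite in_itv/= => /andP[x1 _]; exact: lt_le_trans x1.
Qed.

(** Half of the exponential absorbs the extra factor [x], at the cost of a constant [2 / t]; the
    other half leaves an integral of exponent [p - 1] and rate [t / 2], finite by scaling from rate
    [s]. *)
Lemma gamma_integral_lty p s t : 0 < p -> 0 < s -> 0 < t ->
  (gamma_integral (p - 1) s < +oo)%E -> (gamma_integral p t < +oo)%E.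
Proof.
move=> p0 s0 t0 fins.
have t20 : 0 < t / 2 by rewrite divr_gt0.
have fin2 : (gamma_integral (p - 1) (t / 2) < +oo)%E.
  rewrite gamma_integral_scale// lte_mul_pinfty ?lee_fin ?invr_ge0 ?powR_ge0//.
  move: fins; rewrite gamma_integral_scale//.
  have : (0 < (s `^ (p - 1 + 1))^-1%:E)%E by rewrite lte_fin invr_gt0 powR_gt0.
  have := gamma_integral_ge0 (p - 1) 1.
  by case: (gamma_integral _ _) => [r| |]//= _ c0; rewrite ?ltry// gt0_muley.
apply: (@le_lt_trans _ _ ((2 / t)%:E * gamma_integral (p - 1) (t / 2)))%E; last first.
  by rewrite lte_mul_pinfty// lee_fin divr_ge0// ltW.
rewrite -ge0_integralZl; last 4 first.
- exact: measurable_Rpos.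
- by apply/measurable_EFinP; exact: measurable_powR_expR.
- by move=> x _; rewrite lee_fin mulr_ge0// ?powR_ge0 ?expR_ge0.
- by rewrite lee_fin divr_ge0// ltW.
apply: ge0_le_integral; rewrite ?measurable_Rpos//.
- exact: measurable_Rpos.
- by move=> x _; rewrite lee_fin mulr_ge0// ?powR_ge0 ?expR_ge0.
- by apply/measurable_EFinP; exact: measurable_powR_expR.
- apply/measurable_EFinP; apply: measurable_funM => //; exact: measurable_powR_expR.
move=> x /= x0; rewrite -EFinM lee_fin -mulr_powRB1 ?(ltW x0)//.
have -> : - (t * x) = - (t / 2 * x) + - (t / 2 * x) by field.
rewrite expRD.
(* This is [1 + y <= expR y] at [y = t / 2 * x]. *)
have key : x <= 2 / t * expR (t / 2 * x).
  rewrite -ler_pdivrMl ?divr_gt0// invf_div (le_trans _ (expR_ge1Dx _))//; lra.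
have key2 : x * expR (- (t / 2 * x)) <= 2 / t.
  by rewrite expRN ler_pdivrMr ?expR_gt0.
have q0 : 0 <= x `^ (p - 1) * expR (- (t / 2 * x)) by rewrite mulr_ge0 ?powR_ge0 ?expR_ge0.
have := ler_wpM2r q0 key2; apply: le_trans; rewrite le_eqVlt; apply/orP; left; apply/eqP; ring.
Qed.

End gamma_integral.

Definition gamma_mass {R : realType} (k theta : R) : R :=
  GammaFn k * theta `^ k.

(* [E[Lam e^(- t Lam)] = gamma_tilted_const k theta / (1 / theta + t)^(k + 1)] *)
Definition gamma_tilted_const {R : realType} (k theta : R) : R :=
  (gamma_mass k theta)^-1 * fine (gamma_integral k 1).

(* the density [x |-> E[Lam / 2 * e^(- Lam |x|)]] of the noise [W] *)
Definition gamma_laplace_pdf {R : realType} (k theta x : R) : R :=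
  2^-1 * (gamma_tilted_const k theta * ((theta^-1 + `|x|) `^ (k + 1))^-1).

(** * Tilted moments of the Gamma law *)

Section gamma_laplace.
Context (R : realType) (d0 : measure_display) (Omega : measurableType d0).
Variables (P : probability Omega R) (Lam W : {RV P >-> R}) (k theta : R).
Hypotheses (k0 : 0 < k) (theta0 : 0 < theta).
Hypotheses (Lam0 : forall w, 0 < Lam w).
Hypothesis gammaLam : gamma_distributed P Lam k theta.
Implicit Types t x y : R.
Notation mu := (@lebesgue_measure R).
Notation Rpos := [set x : R | 0 < x].

Notation C := (gamma_mass k theta).
Notation K := (gamma_tilted_const k theta).
Notation noise_pdf := (gamma_laplace_pdf k theta).

Lemma gamma_pdfE x :
  gamma_pdf k theta x = C^-1 * (x `^ (k - 1) * expR (- (theta^-1 * x))).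
Proof. by rewrite /gamma_pdf mulrC mulNr [x / theta]mulrC. Qed.

Lemma gamma_mass_ge0 : 0 <= C.
Proof.
rewrite mulr_ge0 ?powR_ge0// fine_ge0//; apply: integral_ge0 => x _.
by rewrite lee_fin mulr_ge0 ?powR_ge0 ?expR_ge0.
Qed.
#[local] Hint Resolve gamma_mass_ge0 : core.

Lemma measurable_gamma_pdf (D : set R) : measurable_fun D (gamma_pdf k theta).
Proof.
rewrite (_ : gamma_pdf k theta = fun x => C^-1 * (x `^ (k - 1) * expR (- (theta^-1 * x)))).
  by apply: measurable_funM => //; exact: measurable_powR_expR.
by apply/funext => x; exact: gamma_pdfE.
Qed.

Lemma gamma_pdf_ge0 x : 0 <= gamma_pdf k theta x.
Proof. by rewrite gamma_pdfE !mulr_ge0 ?invr_ge0 ?powR_ge0 ?expR_ge0. Qed.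

(** The law of [Lam] evaluated on the whole line. Both [0 < C] and the finiteness of the Gamma
    integrals are drawn from it. *)
Lemma gamma_integral_mass : (C^-1%:E * gamma_integral (k - 1) theta^-1 = 1)%E.
Proof.
have := gammaLam _ (@measurableT _ R).
rewrite preimage_setT probability_setT setTI => ->.
rewrite -ge0_integralZl.
- by apply: eq_integral => x _; rewrite gamma_pdfE.
- exact: measurable_Rpos.
- by apply/measurable_EFinP; exact: measurable_powR_expR.
- by move=> x _; rewrite lee_fin mulr_ge0// ?powR_ge0 ?expR_ge0.
- by rewrite lee_fin invr_ge0.
Qed.

(* [GammaFn k] is not the junk value [fine +oo = 0] because [P setT = 1]. *)
Lemma gamma_mass_gt0 : 0 < C.
Proof.
rewrite lt0r gamma_mass_ge0 andbT; apply/eqP => C0; move: gamma_integral_mass.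
by rewrite C0 invr0 mul0e => /eqP; rewrite eqe eq_sym oner_eq0.
Qed.
#[local] Hint Resolve gamma_mass_gt0 : core.

Lemma gamma_integral_fin_num t : 0 < t -> gamma_integral k t \is a fin_num.
Proof.
move=> t0; rewrite ge0_fin_numE ?gamma_integral_ge0//.
apply: (@gamma_integral_lty _ k theta^-1) => //; first by rewrite invr_gt0.
move: gamma_integral_mass; have := gamma_integral_ge0 (k - 1) theta^-1.
case: (gamma_integral _ _) => [r| |]//= _; rewrite ?ltry//.
by rewrite gt0_muley ?lte_fin ?invr_gt0.
Qed.

Lemma gamma_tilted_const_gt0 : 0 < K.
Proof.
rewrite mulr_gt0 ?invr_gt0// fine_gt0// gamma_integral_gt0//=.
by rewrite -ge0_fin_numE ?gamma_integral_ge0// gamma_integral_fin_num.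
Qed.
#[local] Hint Resolve gamma_tilted_const_gt0 : core.

Lemma gamma_tilted_moment t : 0 <= t ->
  (\int[P]_w (Lam w * expR (- (t * Lam w)))%:E =
   (K * ((theta^-1 + t) `^ (k + 1))^-1)%:E)%E.
Proof.
move=> t0.
have th'0 : 0 < theta^-1 by rewrite invr_gt0.
have th't : 0 < theta^-1 + t by rewrite ltr_pwDl.
(* The absolute values make [g] nonnegative on all of [R], as [ge0_integral_density] requires; they
   disappear on the values of [Lam], which are positive. *)
pose g (x : R) := (`|x| * expR (- (t * `|x|)))%:E.
have mg : measurable_fun [set: R] g.
  apply/measurable_EFinP; apply: measurable_funM => //.
  by apply: measurableT_comp => //; apply: measurableT_comp => //; exact: measurable_funM.
have g0 x : (0 <= g x)%E by rewrite lee_fin mulr_ge0 ?expR_ge0.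
transitivity (\int[P]_w (g \o Lam) w)%E.
  by apply: eq_integral => w _; rewrite /g/= gtr0_norm.
pose phi : Omega -> measurableTypeR R := Lam.
have mphi : measurable_fun [set: Omega] phi.
  by move=> mT B mB; exact: (@measurable_funP _ _ _ _ setT Lam mT B mB).
transitivity (\int[mu]_(x in Rpos) (g x * (gamma_pdf k theta x)%:E))%E.
  pose nu_ : {measure set (measurableTypeR R) -> \bar R} := pushforward P phi.
  pose nu := nu_ mphi.
  transitivity (\int[nu]_x g x)%E.
    by rewrite /nu/nu_ ge0_integral_pushforward.
  apply: (@ge0_integral_density _ (measurableTypeR R) R mu nu Rpos
    (gamma_pdf k theta)) => //.
  - exact: measurable_Rpos.
  - exact: measurable_gamma_pdf.
  - by move=> x _; exact: gamma_pdf_ge0.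
transitivity (C^-1%:E * gamma_integral k (theta^-1 + t))%E.
  rewrite -ge0_integralZl.
  (* The factor [x] raises the exponent from [k - 1] to [k], and the tilt adds [t] to the rate
     [theta^-1]. *)
  - apply: eq_integral => x /[!inE]/= x0; rewrite /g gtr0_norm// -EFinM gamma_pdfE.
    rewrite -EFinM -(mulr_powRB1 (ltW x0) k0) mulrDl opprD expRD; congr EFin.
    ring.
  - exact: measurable_Rpos.
  - by apply/measurable_EFinP; exact: measurable_powR_expR.
  - by move=> x _; rewrite lee_fin mulr_ge0// ?powR_ge0 ?expR_ge0.
  - by rewrite lee_fin invr_ge0.
rewrite gamma_integral_scale// -(fineK (gamma_integral_fin_num 1 _))// -!EFinM /gamma_tilted_const.
by congr EFin; ring.
Qed.

Lemma gamma_expectation : ('E_P[Lam] = (K * (theta^-1 `^ (k + 1))^-1)%:E)%E.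
Proof.
rewrite unlock -[theta^-1]addr0 -gamma_tilted_moment//.
by apply: eq_integral => w _; rewrite mul0r oppr0 expR0 mulr1.
Qed.

Lemma gamma_mgf_deriv t : 0 <= t ->
  mgf_deriv P Lam (- t) = (K * ((theta^-1 + t) `^ (k + 1))^-1)%:E.
Proof.
move=> t0; rewrite /mgf_deriv unlock -gamma_tilted_moment//.
by apply: eq_integral => w _; rewrite mulNr.
Qed.

(** After factoring [theta^-1 + t = theta^-1 * (1 + t * theta)], only the power of the second factor
    survives in the ratio. *)
Lemma ln_gamma_moment_ratio t : 0 <= t ->
  ln ((K * (theta^-1 `^ (k + 1))^-1) / (K * ((theta^-1 + t) `^ (k + 1))^-1)) =
  (k + 1) * ln (1 + t * theta).
Proof.
move=> t0.
have th'0 : 0 < theta^-1 by rewrite invr_gt0.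
have th't : 0 < theta^-1 + t by rewrite ltr_pwDl.
have tt : 0 < 1 + t * theta by rewrite ltr_pwDl// mulr_ge0// ltW.
rewrite -ln_powR (_ : theta^-1 + t = theta^-1 * (1 + t * theta)); last first.
  field; exact: lt0r_neq0.
rewrite powRM ?(ltW th'0) ?(ltW tt)//; congr ln; field.
by rewrite !gt_eqF// powR_gt0.
Qed.

(** * Density of the noise and differential privacy *)

Hypothesis laplaceW : laplace_given P Lam W.

(** Tonelli exchanges the two integrals; the inner one over [Omega] is then half the tilted moment
    at [t = |x|]. *)
Lemma gamma_laplace_probability (B : set R) : measurable B ->
  (P (W @^-1` B) = \int[mu]_(x in B) (noise_pdf x)%:E)%E.
Proof.
move=> mB; have := laplaceW _ _ (@measurableT _ R) mB.
rewrite preimage_setT setTI => ->.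
pose f (z : Omega * measurableTypeR R) := (laplace_pdf (Lam z.1) z.2 * \1_B z.2)%:E.
have f0 z : (0 <= f z)%E.
  by rewrite lee_fin mulr_ge0// /laplace_pdf mulr_ge0 ?expR_ge0 ?divr_ge0 ?ltW.
have mL : measurable_fun setT (fun z : Omega * measurableTypeR R => Lam z.1 : R).
  exact: measurableT_comp.
have m2 : measurable_fun setT (fun z : Omega * measurableTypeR R => z.2 : R).
  exact: measurable_snd.
have mf : measurable_fun setT f.
  apply/measurable_EFinP; apply: measurable_funM.
    rewrite /laplace_pdf; apply: measurable_funM; first exact: measurable_funM.
    apply: measurableT_comp => //; apply: measurable_funM.
      exact: measurableT_comp.
    exact: measurableT_comp.
  by apply: measurableT_comp => //.
transitivity (\int[P]_w \int[mu]_x f (w, x))%E.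
  apply: eq_integral => w _; rewrite integral_mkcond.
  by apply: eq_integral => x _; rewrite epatch_indic /f/= EFinM.
rewrite (fubini_tonelli f)// [RHS]integral_mkcond.
apply: eq_integral => x _; rewrite epatch_indic/= /gamma_laplace_pdf.
rewrite EFinM -gamma_tilted_moment//.
have ml : measurable_fun setT (fun w => (Lam w * expR (- (`|x| * Lam w)))%:E).
  apply/measurable_EFinP; apply: measurable_funM => //.
  by apply: measurableT_comp => //; apply: measurableT_comp => //; exact: measurable_funM.
have l0 w : (0 <= (Lam w * expR (- (`|x| * Lam w)))%:E)%E.
  by rewrite lee_fin mulr_ge0 ?expR_ge0 ?ltW.
rewrite -ge0_integralZl//.
rewrite -ge0_integralZr//; last 2 first.
- exact: emeasurable_funM.
- by move=> w _; rewrite mule_ge0// lee_fin invr_ge0.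
apply: eq_integral => w _; rewrite /f/laplace_pdf -!EFinM; congr EFin.
by rewrite [`|x| * _]mulrC mulNr; ring.
Qed.

(** Clearing constants and denominators leaves a comparison of [k + 1]-th powers, so by monotonicity
    it is enough that [theta^-1 + |y| <= (1 + t * theta) * (theta^-1 + |x|)]. *)
Lemma gamma_laplace_pdf_shift_le t x y : 0 <= t -> `|y| <= `|x| + t ->
  noise_pdf x <= expR ((k + 1) * ln (1 + t * theta)) * noise_pdf y.
Proof.
move=> t0 yx.
have th'0 : 0 < theta^-1 by rewrite invr_gt0.
have tt : 0 < 1 + t * theta by rewrite ltr_pwDl// mulr_ge0// ltW.
have pos (z : R) : 0 < theta^-1 + `|z| by rewrite ltr_pwDl.
have -> : expR ((k + 1) * ln (1 + t * theta)) = (1 + t * theta) `^ (k + 1).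
  by rewrite /powR gt_eqF.
rewrite /gamma_laplace_pdf [leRHS]mulrCA ler_pM2l ?invr_gt0// [leRHS]mulrCA ler_pM2l//.
rewrite ler_pdivlMr ?powR_gt0// mulrC ler_pdivrMr ?powR_gt0//.
rewrite -powRM ?(ltW tt) ?(ltW (pos x))//.
apply: ge0_ler_powR; rewrite ?nnegrE ?mulr_ge0 ?(ltW tt) ?(ltW (pos _))//.
  by rewrite ltW// addr_gt0.
(* The right-hand side expands to [theta^-1 + |x| + t] plus this cross term. *)
have : 0 <= t * theta * `|x| by rewrite !mulr_ge0// ltW.
have : theta * theta^-1 = 1 by rewrite divff// gt_eqF.
nra.
Qed.

Lemma measurable_gamma_laplace_pdf : measurable_fun [set: R] noise_pdf.
Proof.
apply: measurable_funM => //; apply: measurable_funM => //.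
rewrite (_ : (fun _ => _) = fun x => (theta^-1 + `|x|) `^ (- (k + 1))).
  by apply: (measurableT_comp (@measurable_powR R _)); exact: measurable_funD.
by apply/funext => x; rewrite powRN.
Qed.

Lemma gamma_laplace_pdf_ge0 x : 0 <= noise_pdf x.
Proof.
by apply: mulr_ge0 => //; apply: mulr_ge0; rewrite ?invr_ge0 ?powR_ge0 ?(ltW gamma_tilted_const_gt0).
Qed.

Lemma measurable_gamma_laplace_pdf_shift (S : set R) c :
  measurable_fun S (fun x => (noise_pdf (x - c))%:E).
Proof.
apply/measurable_EFinP/measurable_funTS.
by apply: (measurableT_comp measurable_gamma_laplace_pdf); exact: measurable_funB.
Qed.

Lemma shifted_gamma_laplace_probability c (S : set R) : measurable S ->
  (P ((fun w => (c + W w)%R) @^-1` S) = \int[mu]_(x in S) (noise_pdf (x - c))%:E)%E.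
Proof.
(* The factor 1 matches the form of [ge0_integral_affine] with [a = 1]. *)
move=> mS; pose B := (fun x : R => 1 * x + c) @^-1` S.
have mB : measurable B.
  have mphi : measurable_fun [set: R] (fun x : R => 1 * x + c).
    by apply: measurable_funD => //; exact: measurable_funM.
  by rewrite -[B]setTI; exact: mphi.
rewrite (_ : _ @^-1` S = W @^-1` B); last first.
  by apply/seteqP; split => w /=; rewrite /B/= mul1r addrC.
rewrite gamma_laplace_probability// (@ge0_integral_affine _ 1 c S)//.
- by rewrite mul1e; apply: eq_integral => x _; rewrite mul1r addrK.
- exact: measurable_gamma_laplace_pdf_shift.
- by move=> x _; rewrite lee_fin gamma_laplace_pdf_ge0.
Qed.

(** The two output densities are translates of [noise_pdf] by at most [dq] from each other, so the
    pointwise bound integrates over [S]. *)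
Lemma gamma_laplace_DP (D : Type) (adj : D -> D -> Prop) (q : D -> R) (dq : R) :
  0 <= dq -> sensitivity adj q = dq%:E ->
  eps_DP P adj (rand_laplace_mech q W) ((k + 1) * ln (1 + dq * theta)).
Proof.
move=> dq0 hdq d d' dd' S mS.
have qdd' : `|q d - q d'| <= dq.
  by rewrite -lee_fin -hdq; apply: ereal_sup_ubound; exists d, d'.
rewrite !shifted_gamma_laplace_probability// -ge0_integralZl//; last 2 first.
- exact: measurable_gamma_laplace_pdf_shift.
- by move=> x _; rewrite lee_fin gamma_laplace_pdf_ge0.
apply: ge0_le_integral => //.
- by move=> x _; rewrite lee_fin gamma_laplace_pdf_ge0.
- exact: measurable_gamma_laplace_pdf_shift.
- by apply: emeasurable_funM => //; exact: measurable_gamma_laplace_pdf_shift.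
move=> x _; rewrite -EFinM lee_fin gamma_laplace_pdf_shift_le//.
rewrite (_ : x - q d' = (x - q d) + (q d - q d')); last by ring.
by rewrite (le_trans (ler_normD _ _))// lerD2l.
Qed.

End gamma_laplace.

Theorem mainTheorem9 (R : realType) (D : Type) (adj : D -> D -> Prop)
  (adj_sym : forall d d', adj d d' -> adj d' d)
  (q : D -> R) (dq : R) (dq_pos : 0 < dq)
  (hdq : sensitivity adj q = dq%:E)
  (k theta : R) (k_pos : 0 < k) (theta_pos : 0 < theta)
  (d0 : measure_display) (Omega : measurableType d0)
  (P : probability Omega R) (Lam W : {RV P >-> R})
  (Lam_pos : forall w, 0 < Lam w)
  (hLam : gamma_distributed P Lam k theta)
  (hW : laplace_given P Lam W) :
  eps_DP P adj (rand_laplace_mech q W) ((k + 1) * ln (1 + dq * theta)) /\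
  exists e m : R,
    ('E_P[Lam] = e%:E)%E /\ mgf_deriv P Lam (- dq) = m%:E /\
    ln (e / m) = (k + 1) * ln (1 + dq * theta).
Proof.
split.
  by apply: (@gamma_laplace_DP _ _ _ P Lam W) => //; exact: ltW.
(* The witnesses are the closed forms of the tilted moment at [t = 0] and [t = dq]. *)
exists (gamma_tilted_const k theta * (theta^-1 `^ (k + 1))^-1).
exists (gamma_tilted_const k theta * ((theta^-1 + dq) `^ (k + 1))^-1).
split; first exact: gamma_expectation.
split; first by apply: gamma_mgf_deriv => //; exact: ltW.
by apply: (@ln_gamma_moment_ratio _ _ _ P Lam) => //; exact: ltW.
Qed.
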